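(* Let $\pi\colon X\to Y$ be a mean equicontinuous factor map between actions of a countable amenable group $G$ on compact metrizable spaces. Then $$RP(\pi)=RBP(\pi)=P(\pi)=BP(\pi),$$ and this relation is a closed invariant equivalence relation on $X$.
   Context: $G$ is a countable (discrete) amenable group; a Følner sequence is a sequence $(F_n)$ of nonempty finite subsets of $G$ with $|F_n\Delta gF_n|/|F_n|\to 0$ for all $g\in G$. An action $X$ of $G$ is a compact metrizable space $X$ with a homomorphism from $G$ to the homeomorphisms of $X$, written $(g,x)\mapsto g.x$; $d$ denotes a metric inducing the topology of $X$ (the notions below do not depend on its choice). A factor map $\pi\colon X\to Y$ is a continuous surjection with $\pi(g.x)=g.\pi(x)$ for all $g\in G$, $x\in X$, and $R(\pi):=\{(x,x')\in X^2;\ \pi(x)=\pi(x')\}$. The Weyl pseudometric is $D(x,x'):=\sup_{(F_n)}\limsup_{n\to\infty}\frac1{|F_n|}\sum_{g\in F_n}d(g.x,g.x')$, the supremum being over all Følner sequences. A pair $(x,x')$ is Banach proximal if $D(x,x')=0$; a sequence $(x_n,x_n')$ in $X^2$ is asymptotically Banach proximal if $D(x_n,x_n')\to0$. The factor map $\pi$ is mean equicontinuous if for every convergent sequence in $R(\pi)$ the sequence is asymptotically Banach proximal if and only if its limit is Banach proximal. Let $\check d(x,x'):=\inf_{g\in G}d(g.x,g.x')$. A pair is proximal if $\check d(x,x')=0$; a sequence $(x_n,x_n')$ is asymptotically proximal if $\check d(x_n,x_n')\to0$. $P(\pi)$ is the set of proximal pairs in $R(\pi)$; $BP(\pi)$ is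 the set of Banach proximal pairs in $R(\pi)$; $RP(\pi)$ is the set of limit points of asymptotically proximal sequences in $R(\pi)$; $RBP(\pi)$ is the set of limits of (convergent) asymptotically Banach proximal sequences in $R(\pi)$. A relation $R\subseteq X^2$ is invariant if $(x,x')\in R$ implies $(g.x,g.x')\in R$ for all $g\in G$; closed means closed in $X^2$. *)

(* Defs.v *)
From mathcomp Require Import all_boot all_order all_algebra.
From mathcomp Require Import finmap.
From mathcomp Require Import all_classical all_reals all_analysis.

Set Implicit Arguments.
Unset Strict Implicit.
Unset Printing Implicit Defensive.

Import Order.TTheory GRing.Theory Num.Theory.
Import numFieldTopology.Exports.

Local Open Scope classical_set_scope.
Local Open Scope ring_scope.

Section Amenability.
Context (R : realType) (G : groupType).

Definition ltranslate (g : G) (A : {fset G}) : {fset G} :=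
  [fset (g * h)%g | h in A]%fset.

Definition symdiff (A B : {fset G}) : {fset G} :=
  ((A `\` B) `|` (B `\` A))%fset.

Definition folner (F : nat -> {fset G}) : Prop :=
  (forall n, F n != fset0) /\
  (forall g : G,
    #|` symdiff (F n) (ltranslate g (F n))|%:R / #|` F n|%:R
      @[n --> \oo] --> (0 : R)).

Definition amenable : Prop := exists F : nat -> {fset G}, folner F.

End Amenability.
Arguments folner : clear implicits.
Arguments amenable : clear implicits.

Section Actions.
Context (G : groupType).

(* Each [act g] is then a homeomorphism, with continuous inverse
   [act g^-1]. *)
Record is_action (X : topologicalType) (act : G -> X -> X) : Prop := {
  act_one : forall x, act 1%g x = x;
  act_mul : forall g h x, act (g * h)%g x = act g (act h x);
  act_continuous : forall g, continuous (act g)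
}.

Record is_factor_map (X Y : topologicalType)
    (actX : G -> X -> X) (actY : G -> Y -> Y) (pi : X -> Y) : Prop := {
  factor_continuous : continuous pi;
  factor_surjective : forall y, exists x, pi x = y;
  factor_equivariant : forall g x, pi (actX g x) = actY g (pi x)
}.

Definition invariant_rel (X : Type) (act : G -> X -> X) (S : set (X * X)) :
  Prop := forall g x x', S (x, x') -> S (act g x, act g x').

End Actions.

Definition equivalence_set (X : Type) (S : set (X * X)) : Prop :=
  RelationClasses.Equivalence (fun x x' => S (x, x')).

Section Proximality.
Context (R : realType) (G : groupType) (X : metricType R).
Variable act : G -> X -> X.

Definition mean_dist (A : {fset G}) (x x' : X) : R :=
  (\sum_(g <- A) mdist (act g x) (act g x')) / #|` A|%:R.

(* The values are in the extended reals only so that the limsup and the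
   supremum are total; they are finite when [X] is compact and [G] amenable. *)
Definition weyl_dist (p : X * X) : \bar R :=
  ereal_sup [set limn_esup (fun n => (mean_dist (F n) p.1 p.2)%:E)
            | F in folner R G].

Definition banach_proximal (p : X * X) : Prop := weyl_dist p = 0%E.

Definition asymp_banach_proximal (u : nat -> X * X) : Prop :=
  weyl_dist (u n) @[n --> \oo] --> 0%E.

Definition check_dist (p : X * X) : R :=
  inf [set mdist (act g p.1) (act g p.2) | g in [set: G]].

Definition proximal (p : X * X) : Prop := check_dist p = 0.

Definition asymp_proximal (u : nat -> X * X) : Prop :=
  check_dist (u n) @[n --> \oo] --> (0 : R).

End Proximality.

Definition fibre_rel (X Y : Type) (pi : X -> Y) : set (X * X) :=
  [set p | pi p.1 = pi p.2].

Section Relations.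
Context (R : realType) (G : groupType) (X : metricType R) (Y : Type).
Variables (act : G -> X -> X) (pi : X -> Y).

Definition mean_equicontinuous : Prop :=
  forall (u : nat -> X * X) (p : X * X),
    (forall n, fibre_rel pi (u n)) -> u n @[n --> \oo] --> p ->
    (asymp_banach_proximal act u <-> banach_proximal act p).

Definition P_rel : set (X * X) :=
  [set p | fibre_rel pi p /\ proximal act p].

Definition BP_rel : set (X * X) :=
  [set p | fibre_rel pi p /\ banach_proximal act p].

Definition RP_rel : set (X * X) :=
  [set p | exists u : nat -> X * X,
    [/\ forall n, fibre_rel pi (u n), asymp_proximal act u &
        cluster (u n @[n --> \oo]) p]].

Definition RBP_rel : set (X * X) :=
  [set p | exists u : nat -> X * X,
    [/\ forall n, fibre_rel pi (u n), asymp_banach_proximal act u &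
        u n @[n --> \oo] --> p]].

End Relations.

(* Main.v *)
Require Import Defs.
From mathcomp Require Import all_boot all_order all_algebra.
From mathcomp Require Import finmap.
From mathcomp Require Import all_classical all_reals all_analysis.
From mathcomp Require Import lra.

(** The Weyl distance is constant along orbits of the diagonal action: the
    average of [d(g.h.x, g.h.x')] over [A] is the average of [d(g.x, g.x')] over
    the right translate [A h], and right translation preserves Folner sequences
    because it commutes with the left translations that define them
    ([folner_rtranslate], [weyl_dist_act]).

    The inclusion [RP_subset_BP] is the heart of the matter.  Let [u n] be an
    asymptotically proximal sequence in the fibre relation, converging to [p].
    Move each [u n] along its orbit, by some [g n], to a pair whose entries are
    almost as close as the orbit permits.  By compactness a subsequence of the
    moved pairs converges, and its limit is a diagonal pair, which is Banach
    proximal.  Mean equicontinuity makes the moved pairs asymptotically Banach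
    proximal; by invariance so are the original ones; and mean equicontinuity,
    read in the other direction, makes [p] Banach proximal.

    Conversely an infimum is at most an average, so Banach proximal pairs are
    proximal ([banach_proximal_proximal]), and proximal pairs are in [RP_rel]
    through constant sequences, so that [RP_rel], [P_rel] and [BP_rel] agree.
    That [RBP_rel] agrees with [BP_rel] is a reading of mean equicontinuity, and
    so is closedness, applied to sequences of Banach proximal pairs.

    For the equivalence relation, Banach proximality means that the averages
    tend to zero along every Folner sequence ([banach_proximalP]), which passes
    through the triangle inequality. *)

Set Implicit Arguments.
Unset Strict Implicit.
Unset Printing Implicit Defensive.

Import Order.TTheory GRing.Theory Num.Theory.
Import numFieldTopology.Exports.

Local Open Scope classical_set_scope.
Local Open Scope ring_scope.

(** * Sequences in pseudometric spaces *)

Lemma cvg_in_balls (R : realType) (T : pseudoMetricType R) (u : nat -> T)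
    (p : T) :
  (forall n, ball p n.+1%:R^-1 (u n)) -> u n @[n --> \oo] --> p.
Proof.
move=> pu; apply/cvg_ballP => e e0.
have := near_infty_natSinv_lt (PosNum e0); apply: filterS => n /= ne.
exact: le_ball (ltW ne) _ (pu n).
Qed.

Lemma cvg_ge_id (k : nat -> nat) :
  (forall n, (n <= k n)%N) -> k n @[n --> \oo] --> \oo.
Proof.
move=> kge A [N _ NA]; exists N => // n /= Nn.
by apply: NA; exact: leq_trans Nn (kge n).
Qed.

(** The reindexing need not be increasing: [n <= k n] is enough to transport
    limits along it. *)
Lemma cluster_subsequence (R : realType) (T : pseudoMetricType R)
    (u : nat -> T) (p : T) :
  cluster (u n @[n --> \oo]) p ->
  exists k : nat -> nat,
    (forall n, (n <= k n)%N) /\ u (k n) @[n --> \oo] --> p.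
Proof.
move=> up.
have /choice[k kP] n : exists m, (n <= m)%N /\ ball p n.+1%:R^-1 (u m).
  have tail : (u m @[m --> \oo]) [set u m | m in [set m | (n <= m)%N]].
    by exists n => // m /= nm; exists m.
  have nbh : nbhs p (ball p (n.+1%:R^-1 : R)).
    by apply: nbhsx_ballx; rewrite invr_gt0.
  by have [_ [[m nm <-] pm]] := up _ _ tail nbh; exists m.
exists k; split=> [n|]; first by have [] := kP n.
by apply: cvg_in_balls => n; have [] := kP n.
Qed.

Lemma closure_sequence (R : realType) (T : pseudoMetricType R) (A : set T)
    (p : T) :
  closure A p ->
  exists u : nat -> T, (forall n, A (u n)) /\ u n @[n --> \oo] --> p.
Proof.
move=> Ap.
have /choice[u uP] n : exists x, A x /\ ball p n.+1%:R^-1 x.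
  have [|x [Ax px]] := Ap (ball p (n.+1%:R^-1 : R)); last by exists x.
  by apply: nbhsx_ballx; rewrite invr_gt0.
exists u; split=> [n|]; first by have [] := uP n.
by apply: cvg_in_balls => n; have [] := uP n.
Qed.

Lemma compact_subsequence (R : realType) (T : pseudoMetricType R)
    (u : nat -> T) :
  compact [set: T] ->
  exists (p : T) (k : nat -> nat),
    (forall n, (n <= k n)%N) /\ u (k n) @[n --> \oo] --> p.
Proof.
move=> cT.
have [p [_ /cluster_subsequence up]] :
    [set: T] `&` cluster (u n @[n --> \oo]) !=set0.
  by apply: cT; exact: filterT.
by exists p.
Qed.

(** The distance separates points, so the limit of pairs whose entries merge
    lies on the diagonal. *)
Lemma cvg_mdist0_diag (R : realType) (X : metricType R) (w : nat -> X * X)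
    (q : X * X) :
  w n @[n --> \oo] --> q ->
  mdist (w n).1 (w n).2 @[n --> \oo] --> (0 : R) -> q.1 = q.2.
Proof.
move=> wq w0; apply: mdist_positivity; apply/eqP.
rewrite eq_le mdist_ge0 andbT; apply/ler_addgt0Pl => e e0; rewrite addr0.
have e3 : 0 < e / 3 by rewrite divr_gt0.
have w1 : (w n).1 @[n --> \oo] --> q.1 by exact: cvg_comp wq cvg_fst.
have w2 : (w n).2 @[n --> \oo] --> q.2 by exact: cvg_comp wq cvg_snd.
near \oo => n.
have n1 : mdist q.1 (w n).1 < e / 3.
  near: n; exact: (metricType_numDomainType.cvgr_dist_lt
    (f := fun n => (w n).1) w1 e3).
have n2 : mdist q.2 (w n).2 < e / 3.
  near: n; exact: (metricType_numDomainType.cvgr_dist_lt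
    (f := fun n => (w n).2) w2 e3).
have n0 : mdist (w n).1 (w n).2 < e / 3.
  by near: n; exact: (cvgr_lt _ w0 _ e3).
have t1 := metric_triangle q.1 (w n).1 q.2.
have t2 := metric_triangle (w n).1 (w n).2 q.2.
rewrite [mdist (w n).2 q.2]metric_sym in t2.
lra.
Unshelve. all: by end_near.
Qed.

(** * Right translates of Folner sequences *)

Definition rtranslate (G : groupType) (A : {fset G}) (h : G) : {fset G} :=
  [fset (g * h)%g | g in A]%fset.

Lemma card_rtranslate (G : groupType) (A : {fset G}) (h : G) :
  #|` rtranslate A h| = #|` A|.
Proof. by rewrite card_imfset //; exact: mulIg. Qed.

Lemma mem_rtranslate (G : groupType) (A : {fset G}) (h x : G) :
  (x \in rtranslate A h) = ((x * h^-1)%g \in A).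
Proof.
rewrite -[X in X \in rtranslate _ _](mulgVK h).
by rewrite (mem_imfset _ _ (@mulIg _ h)).
Qed.

Lemma mem_ltranslate (G : groupType) (g : G) (A : {fset G}) (x : G) :
  (x \in ltranslate g A) = ((g^-1 * x)%g \in A).
Proof.
rewrite -[X in X \in ltranslate _ _](mulVKg g).
by rewrite (mem_imfset _ _ (@mulgI _ g)).
Qed.

Lemma symdiff_rtranslate (G : groupType) (g h : G) (A : {fset G}) :
  symdiff (rtranslate A h) (ltranslate g (rtranslate A h)) =
  rtranslate (symdiff A (ltranslate g A)) h.
Proof.
apply/fsetP => x.
by rewrite mem_rtranslate /symdiff !in_fsetU !in_fsetD !mem_ltranslate
  !mem_rtranslate mulgA.
Qed.

(** Left and right translations commute, and right translation preserves
    cardinality, so the Folner ratios do not change at all. *)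
Lemma folner_rtranslate (R : realType) (G : groupType) (F : nat -> {fset G})
    (h : G) :
  folner R G F -> folner R G (fun n => rtranslate (F n) h).
Proof.
move=> [F0 FF]; split=> [n|g].
  by rewrite -cardfs_eq0 card_rtranslate cardfs_eq0.
by under eq_fun do rewrite symdiff_rtranslate !card_rtranslate; exact: FF.
Qed.

(** * The Weyl pseudometric *)

Section WeylDistance.
Context (R : realType) (G : groupType) (X : metricType R).
Variable act : G -> X -> X.
Hypothesis actP : is_action act.

Lemma mean_dist_ge0 (A : {fset G}) (x x' : X) : 0 <= mean_dist act A x x'.
Proof. by rewrite divr_ge0 // sumr_ge0 // => g _; exact: mdist_ge0. Qed.

Lemma mean_dist_xx (A : {fset G}) (x : X) : mean_dist act A x x = 0.
Proof.
by rewrite /mean_dist big1 ?mul0r // => g _; rewrite mdistxx.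
Qed.

Lemma mean_dist_sym (A : {fset G}) (x x' : X) :
  mean_dist act A x x' = mean_dist act A x' x.
Proof.
by congr (_ / _); apply: eq_bigr => g _; rewrite metric_sym.
Qed.

Lemma mean_dist_triangle (A : {fset G}) (x y z : X) :
  mean_dist act A x z <= mean_dist act A x y + mean_dist act A y z.
Proof.
rewrite -mulrDl ler_wpM2r ?invr_ge0 // -big_split.
by apply: ler_sum => g _; exact: metric_triangle.
Qed.

Lemma mean_dist_act (A : {fset G}) (h : G) (x x' : X) :
  mean_dist act A (act h x) (act h x') = mean_dist act (rtranslate A h) x x'.
Proof.
rewrite /mean_dist card_rtranslate big_imfset /=; last first.
  by move=> ? ? _ _ /mulIg.
by congr (_ / _); apply: eq_bigr => g _; rewrite !(act_mul actP).
Qed.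

Lemma weyl_dist_act_le (h : G) (p : X * X) :
  (weyl_dist act (act h p.1, act h p.2) <= weyl_dist act p)%E.
Proof.
apply: ge_ereal_sup => _ [F FF <-] /=.
under eq_fun do rewrite mean_dist_act.
apply: ereal_sup_ubound.
by exists (fun n => rtranslate (F n) h) => //; exact: folner_rtranslate.
Qed.

(** The inequality for [h^-1] at the translated pair is the reverse inequality
    for [h]. *)
Lemma weyl_dist_act (h : G) (p : X * X) :
  weyl_dist act (act h p.1, act h p.2) = weyl_dist act p.
Proof.
apply/eqP; rewrite eq_le weyl_dist_act_le /=.
have := weyl_dist_act_le (h^-1)%g (act h p.1, act h p.2).
by rewrite /= -!(act_mul actP) mulVg !(act_one actP) -surjective_pairing.
Qed.

(** Amenability is what prevents the supremum from ranging over the empty set,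
    where it would be [-oo]. *)
Lemma banach_proximalP (amenable_G : amenable R G) (p : X * X) :
  banach_proximal act p <->
  forall F, folner R G F ->
    mean_dist act (F n) p.1 p.2 @[n --> \oo] --> (0 : R).
Proof.
split=> [p0 F FF|p0].
  have : ((mean_dist act (F n) p.1 p.2)%:E @[n --> \oo] --> 0%:E)%E.
    apply: limn_esup_le_cvg => [|n]; last by rewrite lee_fin mean_dist_ge0.
    have <- : weyl_dist act p = 0%:E := p0.
    by apply: ereal_sup_ubound; exists F.
  by move/fine_cvgP => [].
have lim0 F : folner R G F ->
    limn_esup (fun n => (mean_dist act (F n) p.1 p.2)%:E) = 0%E.
  move=> /p0 pF; apply: (cvg_limn_einf_sup _).2.
  by apply/fine_cvgP; split=> //; near=> n.
rewrite /banach_proximal /weyl_dist.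
apply/eqP; rewrite eq_le; apply/andP; split.
  by apply: ge_ereal_sup => _ [F FF <-]; rewrite lim0.
have [F FF] := amenable_G; rewrite -(lim0 F FF).
by apply: ereal_sup_ubound; exists F.
Unshelve. all: by end_near.
Qed.

Lemma banach_proximal_diag (amenable_G : amenable R G) (x : X) :
  banach_proximal act (x, x).
Proof.
apply/(banach_proximalP amenable_G) => F _ /=.
by under eq_fun do rewrite mean_dist_xx; exact: cvg_cst.
Qed.

Lemma banach_proximal_sym (x x' : X) :
  banach_proximal act (x, x') -> banach_proximal act (x', x).
Proof.
rewrite /banach_proximal /weyl_dist /= => <-; congr ereal_sup.
apply: eq_imagel => F _; congr limn_esup.
by apply/funext => n; rewrite mean_dist_sym.
Qed.

Lemma banach_proximal_trans (amenable_G : amenable R G) (x y z : X) :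
  banach_proximal act (x, y) -> banach_proximal act (y, z) ->
  banach_proximal act (x, z).
Proof.
move=> /(banach_proximalP amenable_G) xy /(banach_proximalP amenable_G) yz.
apply/(banach_proximalP amenable_G) => F FF /=.
have xyz : mean_dist act (F n) x y + mean_dist act (F n) y z @[n --> \oo]
    --> (0 : R).
  by rewrite -[X in _ --> X]addr0; apply: cvgD; [exact: xy|exact: yz].
apply: (squeeze_cvgr _ (cvg_cst (0 : R)) xyz).
by apply: nearW => n; rewrite mean_dist_ge0; exact: mean_dist_triangle.
Qed.

(** * Proximality *)

Let orbit_dist (p : X * X) : set R :=
  [set mdist (act g p.1) (act g p.2) | g in [set: G]].

Let orbit_dist_has_inf (p : X * X) : has_inf (orbit_dist p).
Proof.
split; first by exists (mdist (act 1%g p.1) (act 1%g p.2)); exists 1%g.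
by exists 0 => _ [g _ <-]; exact: mdist_ge0.
Qed.

Lemma check_dist_ge0 (p : X * X) : 0 <= check_dist act p.
Proof.
apply: lb_le_inf; first by case: (orbit_dist_has_inf p).
by move=> _ [g _ <-]; exact: mdist_ge0.
Qed.

Lemma check_dist_le (g : G) (p : X * X) :
  check_dist act p <= mdist (act g p.1) (act g p.2).
Proof. by apply: ge_inf; [case: (orbit_dist_has_inf p)|exists g]. Qed.

Lemma check_dist_adherent (p : X * X) (e : R) : 0 < e ->
  exists g, mdist (act g p.1) (act g p.2) < check_dist act p + e.
Proof.
move=> e0; have [_ [g _ <-]] := inf_adherent e0 (orbit_dist_has_inf p).
by exists g.
Qed.

Lemma check_dist_le_mean (A : {fset G}) (p : X * X) : A != fset0 ->
  check_dist act p <= mean_dist act A p.1 p.2.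
Proof.
move=> A0; rewrite ler_pdivlMr ?ltr0n ?cardfs_gt0 //.
have -> : check_dist act p * #|` A|%:R = \sum_(g <- A) check_dist act p.
  by rewrite big_const_seq count_predT iter_addr_0 mulr_natr.
by apply: ler_sum => g _; exact: check_dist_le.
Qed.

Lemma banach_proximal_proximal (amenable_G : amenable R G) (p : X * X) :
  banach_proximal act p -> proximal act p.
Proof.
move=> /(banach_proximalP amenable_G) p0; have [F FF] := amenable_G.
apply/eqP; rewrite eq_le check_dist_ge0 andbT.
rewrite -(cvg_lim (@Rhausdorff R) (p0 F FF)).
apply: limr_ge; first exact: cvgP (p0 F FF).
by apply: nearW => n; apply: check_dist_le_mean; case: FF.
Qed.

End WeylDistance.

(** * Mean equicontinuous factor maps *)

Section MeanEquicontinuous.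
Context (R : realType) (G : groupType) (X Y : metricType R).
Hypothesis amenable_G : amenable R G.
Hypothesis compact_X : compact [set: X].
Variables (actX : G -> X -> X) (actY : G -> Y -> Y) (pi : X -> Y).
Hypotheses (actXP : is_action actX) (piP : is_factor_map actX actY pi).
Hypothesis pi_meq : mean_equicontinuous actX pi.

Lemma fibre_rel_act (g : G) (p : X * X) :
  fibre_rel pi p -> fibre_rel pi (actX g p.1, actX g p.2).
Proof.
by rewrite /fibre_rel /= => pp; rewrite !(factor_equivariant piP) pp.
Qed.

(** The fibre relation is closed since [pi] is continuous and [Y] is
    Hausdorff. *)
Lemma fibre_rel_cvg (u : nat -> X * X) (p : X * X) :
  (forall n, fibre_rel pi (u n)) -> u n @[n --> \oo] --> p -> fibre_rel pi p.
Proof.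
move=> uR up.
have pi1 : pi (u n).1 @[n --> \oo] --> pi p.1.
  apply: continuous_cvg; first exact: factor_continuous piP p.1.
  exact: cvg_comp up cvg_fst.
have pi2 : pi (u n).2 @[n --> \oo] --> pi p.2.
  apply: continuous_cvg; first exact: factor_continuous piP p.2.
  exact: cvg_comp up cvg_snd.
have uE : (fun n => pi (u n).1) = (fun n => pi (u n).2).
  by apply/funext => n; exact: uR.
rewrite uE in pi1.
exact: (cvg_unique (@metric_hausdorff _ Y) pi1 pi2).
Qed.

Lemma RBP_BP : RBP_rel actX pi = BP_rel actX pi.
Proof.
apply/seteqP; split=> p.
  move=> [u [uR u0 up]]; split; first exact: fibre_rel_cvg uR up.
  exact/(pi_meq uR up).
move=> [pR p0]; exists (fun=> p); split=> //; last exact: cvg_cst.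
exact/(pi_meq (fun=> pR) (cvg_cst p)).
Qed.

Lemma RP_subset_BP : RP_rel actX pi `<=` BP_rel actX pi.
Proof.
move=> p [u [uR u0 /cluster_subsequence[k [kge up]]]].
(* A slack vanishing with [n], since the infimum over the orbit need not be
   attained. *)
have /choice[g gP] n : exists g,
    mdist (actX g (u (k n)).1) (actX g (u (k n)).2) <
    check_dist actX (u (k n)) + n.+1%:R^-1.
  by apply: check_dist_adherent; rewrite invr_gt0.
pose w n := (actX (g n) (u (k n)).1, actX (g n) (u (k n)).2).
have w0 : mdist (w n).1 (w n).2 @[n --> \oo] --> (0 : R).
  have sum0 : check_dist actX (u (k n)) + n.+1%:R^-1 @[n --> \oo] --> (0 : R).
    rewrite -[X in _ --> X]addr0; apply: cvgD; last exact: cvg_harmonic.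
    exact: cvg_comp (cvg_ge_id kge) u0.
  apply: (squeeze_cvgr _ (cvg_cst (0 : R)) sum0).
  by apply: nearW => n; rewrite mdist_ge0 (ltW (gP n)).
have compact_XX : compact [set: X * X].
  by rewrite -setXTT; exact: compact_setX.
have [q [j [jge wq]]] := compact_subsequence w compact_XX.
have qdiag : q.1 = q.2.
  exact: cvg_mdist0_diag wq (cvg_comp _ _ (cvg_ge_id jge) w0).
have q_bp : banach_proximal actX q.
  by rewrite [q]surjective_pairing -qdiag; exact: banach_proximal_diag.
have wR n : fibre_rel pi (w (j n)) by exact: fibre_rel_act.
have vp : u (k (j n)) @[n --> \oo] --> p.
  exact: cvg_comp (cvg_ge_id jge) up.
have vR n : fibre_rel pi (u (k (j n))) by exact: uR.
split; first exact: fibre_rel_cvg vR vp.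
apply/(pi_meq vR vp).
have := (pi_meq wR wq).2 q_bp; rewrite /asymp_banach_proximal.
by under eq_fun do rewrite (weyl_dist_act actXP).
Qed.

Lemma BP_subset_P : BP_rel actX pi `<=` P_rel actX pi.
Proof. by move=> p [pR p0]; split=> //; exact: banach_proximal_proximal. Qed.

Lemma P_subset_RP : P_rel actX pi `<=` RP_rel actX pi.
Proof.
move=> p [pR p0]; exists (fun=> p); split=> //.
  by rewrite /asymp_proximal p0; exact: cvg_cst.
move=> A B [N _ NA] /nbhs_singleton Bp; exists p; split=> //.
exact: (NA N (leqnn N)).
Qed.

Lemma closed_BP : closed (BP_rel actX pi).
Proof.
move=> p /closure_sequence[u [uBP up]].
rewrite -RBP_BP; exists u; split=> // [n|]; first by have [] := uBP n.
rewrite /asymp_banach_proximal.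
have -> : (fun n => weyl_dist actX (u n)) = (fun=> 0%E).
  by apply/funext => n; have [] := uBP n.
exact: cvg_cst.
Qed.

Lemma invariant_BP : invariant_rel actX (BP_rel actX pi).
Proof.
move=> g x x' [xR x0]; split; first exact: (fibre_rel_act g xR).
by rewrite /banach_proximal (weyl_dist_act actXP g (x, x')).
Qed.

Lemma equivalence_BP : equivalence_set (BP_rel actX pi).
Proof.
split=> [x|x y [xy0 xy]|x y z [xy0 xy] [yz0 yz]]; split => //.
- exact: banach_proximal_diag.
- exact: banach_proximal_sym.
- exact: etrans xy0 yz0.
- exact: banach_proximal_trans xy yz.
Qed.

End MeanEquicontinuous.

Theorem theorem5p2 (R : realType) (G : groupType)
  (countable_G : countable [set: G]%classic) (amenable_G : amenable R G)
  (X Y : metricType R)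
  (compact_X : compact [set: X]%classic) (compact_Y : compact [set: Y]%classic)
  (actX : G -> X -> X) (actY : G -> Y -> Y)
  (actXP : is_action actX) (actYP : is_action actY)
  (pi : X -> Y) (piP : is_factor_map actX actY pi)
  (pi_meq : mean_equicontinuous actX pi) :
  [/\ RP_rel actX pi = RBP_rel actX pi,
      RBP_rel actX pi = P_rel actX pi &
      P_rel actX pi = BP_rel actX pi] /\
  [/\ closed (BP_rel actX pi),
      invariant_rel actX (BP_rel actX pi) &
      equivalence_set (BP_rel actX pi)].
Proof.
have RP_BP := RP_subset_BP amenable_G compact_X actXP piP pi_meq.
have BP_P := BP_subset_P (actX := actX) (pi := pi) amenable_G.
have P_RP := P_subset_RP (actX := actX) (pi := pi).
have RPE : RP_rel actX pi = BP_rel actX pi.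
  by apply/seteqP; split=> // p /BP_P /P_RP.
have PE : P_rel actX pi = BP_rel actX pi.
  by apply/seteqP; split=> // p /P_RP /RP_BP.
split; first by rewrite RPE PE (RBP_BP piP pi_meq).
split; first exact: (closed_BP piP pi_meq).
- exact: (invariant_BP actXP piP).
- exact: equivalence_BP.
Qed.
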